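(* Suppose $\xi_{\mathbf P}>0$ for all $\mathbf P\in\mathcal P$, and put $\alpha_{\mathbf Q}=\sum_{\mathbf P\in\mathcal P}\lambda_{\mathbf{PQ}}/\xi_{\mathbf P}$ for $\mathbf Q\in\mathcal Q$. Then $$\mathbf V^{-1}=\sum_{\mathbf P\in\mathcal P}\frac1{\xi_{\mathbf P}}\mathbf P-\sum_{\mathbf P\in\mathcal P}\sum_{\mathbf Q\in\mathcal Q}\sum_{\mathbf P^*\in\mathcal P}\left(\frac{r\eta_{\mathbf Q}}{1+r\eta_{\mathbf Q}\alpha_{\mathbf Q}}\right)\frac{1}{\xi_{\mathbf P}\xi_{\mathbf P^*}}\mathbf P\mathbf Q\mathbf P^* .$$ Moreover, for $\mathbf R\in\mathcal R$, put $\theta_{\mathbf R}=\sum_{\mathbf Q\in\mathcal Q}\alpha_{\mathbf Q}\lambda_{\mathbf{QR}}(1+r\eta_{\mathbf Q}\alpha_{\mathbf Q})^{-1}$. Then $\mathbf R\mathbf V^{-1}\mathbf R=\theta_{\mathbf R}\mathbf R$, and the generalized least squares estimator $(\mathbf R\mathbf V^{-1}\mathbf R)^{-}\mathbf R\mathbf V^{-1}\mathbf Y$ of $\mathbf R\mathbf X_f\mathbf X_h\boldsymbol\tau$ is equal to $$\frac1{\theta_{\mathbf R}}\sum_{\mathbf P\in\mathcal P}\sum_{\mathbf Q\in\mathcal Q}\frac1{\xi_{\mathbf P}}\left(\frac{1}{1+r\eta_{\mathbf Q}\alpha_{\mathbf Q}}\right)\mathbf{RQP}\mathbf Y,$$ with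 variance matrix $\theta_{\mathbf R}^{-1}\mathbf R$.
   Context: Setting (chain of two randomizations). $\Omega,\Upsilon,\Gamma$ are finite sets, $f\colon\Omega\to\Upsilon$ and $h\colon\Upsilon\to\Gamma$ are surjective maps, and $f$ is equireplicate: every element of $\Upsilon$ has exactly $r$ preimages. $\mathbf X_f$ is the $\Omega\times\Upsilon$ matrix with $(\omega,\upsilon)$-entry $1$ if $f(\omega)=\upsilon$ and $0$ otherwise; $\mathbf X_h$ is the analogous $\Upsilon\times\Gamma$ matrix; $\mathbf D_h=\mathbf X_h'\mathbf X_h$. Primes denote transposes. A transitive permutation group $G$ on a finite set $S$ is stratifiable if the symmetric $0$-$1$ matrices of its symmetrized orbits on $S\times S$ all commute; the orthogonal projectors onto their common eigenspaces (strata) are its stratum projectors. $\mathcal P$ is the set of stratum projectors ($\Omega\times\Omega$ nonzero symmetric, mutually orthogonal idempotents summing to $\mathbf I_\Omega$) of a transitive stratifiable group $G_1$ on $\Omega$. $\mathcal Q$ arises from the stratum projectors $\mathbf Q_\Upsilon$ ($\Upsilon\times\Upsilon$, summing to $\mathbf I_\Upsilon$) of a transitive stratifiable group $G_2$ on $\Upsilon$ (or from a refinement in which some of these are replaced by mutually orthogonal nonzero symmetric sub-idempotents summing to them, all pieces keeping the same coefficient $\eta$): each $\mathbf Q_\Upsilon$ is replaced by the $\Omega\times\Omega$ matrix $\mathbf Q=r^{-1}\mathbf X_f\mathbf Q_\Upsilon\mathbf X_f'$. These are mutually orthogonal symmetric idempotents with sum $\mathbf I_{\mathcal Q}=r^{-1}\mathbf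 X_f\mathbf X_f'$. $\mathcal R$ arises from a set of nonzero symmetric, mutually orthogonal $\Upsilon\times\Upsilon$ idempotents $\mathbf R_\Upsilon$ with sum $\mathbf X_h\mathbf D_h^{-1}\mathbf X_h'$, each replaced by $\mathbf R=r^{-1}\mathbf X_f\mathbf R_\Upsilon\mathbf X_f'$; put $\mathbf I_{\mathcal R}=\sum_{\mathbf R\in\mathcal R}\mathbf R$. Model. $\mathbf Y=\mathbf Z+\mathbf X_f\mathbf W+\mathbf X_f\mathbf X_h\boldsymbol\tau$, where $\boldsymbol\tau\in\mathbb R^\Gamma$ is a fixed vector, $\mathbf Z$ (indexed by $\Omega$) and $\mathbf W$ (indexed by $\Upsilon$) are independent random vectors with mean zero, $\operatorname{Cov}(\mathbf Z)=\sum_{\mathbf P}\xi_{\mathbf P}\mathbf P$ and $\operatorname{Cov}(\mathbf W)=\sum\eta_{\mathbf Q}\mathbf Q_\Upsilon$ with $\xi_{\mathbf P},\eta_{\mathbf Q}\ge 0$. Thus $\operatorname E(\mathbf Y)=\mathbf X_f\mathbf X_h\boldsymbol\tau$ and $\operatorname{Cov}(\mathbf Y)=\mathbf V=\sum_{\mathbf P\in\mathcal P}\xi_{\mathbf P}\mathbf P+r\sum_{\mathbf Q\in\mathcal Q}\eta_{\mathbf Q}\mathbf Q$. The coefficients $\xi_{\mathbf P},\eta_{\mathbf Q}$ are regarded as known. Structure balance (assumed). $\mathcal Q$ is structure balanced in relation to $\mathcal P$: there are scalars $\lambda_{\mathbf{PQ}}$ with $\mathbf Q\mathbf P\mathbf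 I_{\mathcal Q}=\lambda_{\mathbf{PQ}}\mathbf Q$ for all $\mathbf P\in\mathcal P$, $\mathbf Q\in\mathcal Q$. $\mathcal R$ is structure balanced in relation to $\mathcal Q$: there are scalars $\lambda_{\mathbf{QR}}$ with $\mathbf R\mathbf Q\mathbf I_{\mathcal R}=\lambda_{\mathbf{QR}}\mathbf R$ for all $\mathbf Q\in\mathcal Q$, $\mathbf R\in\mathcal R$. $\mathbf A^{-}$ denotes the Moore–Penrose generalized inverse of $\mathbf A$. *)

(* Defs.v *)
From HB Require Import structures.
From mathcomp Require Import all_boot all_order all_algebra all_fingroup.
From mathcomp Require Import all_classical all_reals all_analysis.
Set Implicit Arguments.
Unset Strict Implicit.
Unset Printing Implicit Defensive.
Import Order.TTheory GRing.Theory Num.Theory.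
Local Open Scope ring_scope.

(* A matrix whose rows or columns are indexed by a finite type T is encoded
   as a matrix of size #|T|, row or column i standing for enum_val i : T. *)

Definition design_mx (K : realType) (S T : finType) (f : S -> T) :
    'M[K]_(#|S|, #|T|) :=
  \matrix_(i, j) (f (enum_val i) == enum_val j)%:R.

Section Strata.
Variables (K : realType) (S : finType) (G : {group {perm S}}).

Definition orbital (x : S * S) : {set S * S} :=
  [set ((g : {perm S}) x.1, g x.2) | g in G].

Definition sym_orbital (x : S * S) : {set S * S} :=
  orbital x :|: orbital (x.2, x.1).

(* Every symmetrized orbit occurs as x varies (usually several times). *)
Definition sym_orbital_mx (x : S * S) : 'M[K]_#|S| :=
  \matrix_(i, j) ((enum_val i, enum_val j) \in sym_orbital x)%:R.

Definition stratifiable : Prop :=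
  forall x y, sym_orbital_mx x *m sym_orbital_mx y =
              sym_orbital_mx y *m sym_orbital_mx x.

Definition common_eigenspace (c : S * S -> K) (v : 'cV[K]_#|S|) : Prop :=
  forall x, sym_orbital_mx x *m v = c x *: v.

(* M is the orthogonal projector onto a nonzero common eigenspace. *)
Definition is_stratum_projector (M : 'M[K]_#|S|) : Prop :=
  [/\ M != 0, M^T = M, M *m M = M &
      exists c : S * S -> K, forall v : 'cV[K]_#|S|,
        (exists u, v = M *m u) <-> common_eigenspace c v].

(* The family P enumerates, without repetition, all the stratum projectors. *)
Definition stratum_projectors (I : finType) (P : I -> 'M[K]_#|S|) : Prop :=
  injective P /\
  forall M, is_stratum_projector M <-> exists i, M = P i.

End Strata.

Definition orthogonal_idempotents (K : realType) (n : nat) (I : finType)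
    (P : I -> 'M[K]_n) : Prop :=
  [/\ forall i, P i != 0,
      forall i, (P i)^T = P i,
      forall i, P i *m P i = P i &
      forall i j, i != j -> P i *m P j = 0].

(* Each S i is split into the pieces Q j with s j = i; the case where nothing
   is refined is the one where s is a bijection. *)
Definition refinement (K : realType) (n : nat) (I J : finType)
    (S : I -> 'M[K]_n) (s : J -> I) (Q : J -> 'M[K]_n) : Prop :=
  orthogonal_idempotents Q /\ forall i, S i = \sum_(j | s j == i) Q j.

Definition structure_balanced (K : realType) (n : nat) (I J : finType)
    (P : I -> 'M[K]_n) (Q : J -> 'M[K]_n) (lambda : I -> J -> K) : Prop :=
  forall i j, Q j *m P i *m (\sum_k Q k) = lambda i j *: Q j.

Definition is_moore_penrose (K : realType) (m n : nat)
    (A : 'M[K]_(m, n)) (B : 'M[K]_(n, m)) : Prop :=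
  [/\ A *m B *m A = A, B *m A *m B = B,
      (A *m B)^T = A *m B & (B *m A)^T = B *m A].

(* The four Penrose equations determine B uniquely; 0 is a dummy default. *)
Definition moore_penrose (K : realType) (m n : nat) (A : 'M[K]_(m, n)) :
    'M[K]_(n, m) :=
  xget 0 [set B | is_moore_penrose A B]%classic.

Section RandomVectors.
Context d (T : measurableType d) (K : realType) (Pr : probability T K).

Definition coord (n : nat) (X : T -> 'cV[K]_n) (i : 'I_n) : T -> K :=
  fun t => X t i 0.

(* Measurability is part of membership in Lfun. *)
Definition square_integrable (n : nat) (X : T -> 'cV[K]_n) : Prop :=
  forall i, coord X i \in Lfun Pr 2%:E.

Definition mean_zero (n : nat) (X : T -> 'cV[K]_n) : Prop :=
  forall i, 'E_Pr[coord X i]%E = 0%E.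

(* For square-integrable vectors every covariance is finite, so that fine
   loses nothing. *)
Definition cov_mx (n : nat) (X : T -> 'cV[K]_n) : 'M[K]_n :=
  \matrix_(i, j) fine (covariance Pr (coord X i) (coord X j)).

Definition independent_vectors (m n : nat)
    (X : T -> 'cV[K]_m) (Y : T -> 'cV[K]_n) : Prop :=
  forall A B : set T,
    g_sigma_preimage (coord X) A -> g_sigma_preimage (coord Y) B ->
    Pr (A `&` B)%classic = (Pr A * Pr B)%E.

End RandomVectors.

(* Main.v *)
Require Import Defs.
From HB Require Import structures.
From mathcomp Require Import all_boot all_order all_algebra all_fingroup.
From mathcomp Require Import all_classical all_reals all_analysis.
From mathcomp Require Import measurable_realfun spectral complex ring.
Set Implicit Arguments.
Unset Strict Implicit.
Unset Printing Implicit Defensive.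
Import Order.TTheory GRing.Theory Num.Theory.
Local Open Scope ring_scope.

(** Since G1 and G2 are stratifiable, their symmetrized orbital matrices are
  commuting real symmetric matrices, so by simultaneous diagonalization the
  stratum projectors are mutually orthogonal and sum to the identity; hence
  I_Q R = R and P resolves the identity. Structure balance gives
  Q A I_Q = alpha_Q Q for A = sum_P P / xi_P, which yields
  Q V^-1 = (1 + r eta_Q alpha_Q)^-1 Q A for the stated candidate V^-1; both the
  inversion formula and R V^-1 = sum_Q R Q V^-1 follow. Compressing an
  idempotent shows that lambda_PQ, for fixed Q, and lambda_QR, for fixed R, are
  nonnegative and sum to 1, so alpha_Q and theta_R are positive. *)

(** * Simultaneous diagonalization of commuting symmetric matrices *)

Lemma mulmx_tr_diag (K : realDomainType) m n (A : 'M[K]_(m, n)) i :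
  (A *m A^T) i i = \sum_j A i j ^+ 2.
Proof. by rewrite mxE; apply: eq_bigr => j _; rewrite mxE expr2. Qed.

(** The diagonal of [A *m A^T] holds the squared norms of the rows of [A]. *)
Lemma mulmx_tr_eq0 (K : realDomainType) m n (A : 'M[K]_(m, n)) :
  A *m A^T = 0 -> A = 0.
Proof.
move=> A0; apply/matrixP => i j; rewrite [RHS]mxE.
have /eqP := mulmx_tr_diag A i.
rewrite A0 mxE eq_sym psumr_eq0 => [/allP /(_ j)|k _]; last exact: sqr_ge0.
by rewrite mem_index_enum sqrf_eq0 => /(_ isT) /eqP.
Qed.

(* A common eigenvector exists over K[i]. By symmetry its eigenvalues are real,
   so its real and imaginary parts are real common eigenvectors. *)
Lemma symmetric_common_eigenvector (K : rcfType) (I : finType) n m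
    (A : I -> 'M[K]_n) (U : 'M[K]_(m, n)) :
  (forall i, (A i)^T = A i) -> (forall i j, A i *m A j = A j *m A i) ->
  (forall i, stablemx U (A i)) -> U != 0 ->
  exists v : 'rV[K]_n, exists c : I -> K,
    [/\ v != 0, (v <= U)%MS & forall i, v *m A i = c i *: v].
Proof.
move=> Asym Acomm Ustab U0.
have [B [Bfree eqBU]] : exists B : 'M[K]_(\rank U, n), row_free B /\ (B :=: U)%MS.
  by exists (row_base U); split; [exact: row_base_free|exact: eq_row_base].
have Bstab i : (B *m A i <= B)%MS by rewrite (eqmxMr _ eqBU) eqBU.
(* [A' i] is the restriction of [A i] to the invariant space [U], in the basis [B]; row-freeness of
   [B] transports commutation to these restrictions. *)
have [A' A'E] : exists A' : I -> 'M[K]_(\rank U), forall i, A' i *m B = B *m A i.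
  by exists (fun i => B *m A i *m pinvmx B) => i; rewrite mulmxKpV.
have A'comm i j : A' i *m A' j = A' j *m A' i.
  apply: (row_free_inj Bfree).
  by rewrite -!mulmxA !A'E !(mulmxA (A' _) B) !A'E -!mulmxA Acomm.
pose toC := map_mx (real_complex K).
have toCM p q r (X : 'M[K]_(p, q)) (Y : 'M[K]_(q, r)) :
  toC _ _ (X *m Y) = toC _ _ X *m toC _ _ Y by exact: map_mxM.
have [||w w0 wstab] := @common_eigenvector _ _ [seq toC _ _ (A' i) | i : I].
- by rewrite lt0n mxrank_eq0.
- move=> _ _ /fintype.imageP[i _ ->] /fintype.imageP[j _ ->].
  by rewrite /comm_mx -!toCM A'comm.
have {wstab} wA i : exists a, w *m toC _ _ (A' i) = a *: w.
  have /(allP wstab)/eigenvectorP[a /eigenspaceP wa] :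
    toC _ _ (A' i) \in [seq toC _ _ (A' i) | i : I] by exact: fintype.image_f.
  by exists a.
(* Real and imaginary parts of the complex eigenvector, returned from coordinates in [B] to the
   ambient space. With eigenvalue a + ib, they satisfy the two relations of [re_im]. *)
pose x := map_mx (@complex.Re K) w *m B; pose y := map_mx (@complex.Im K) w *m B.
have re_im i : exists a b, x *m A i = a *: x - b *: y /\ y *m A i = b *: x + a *: y.
  have [[a b] wa] := wA i; exists a, b.
  have hre : map_mx (@complex.Re K) w *m A' i =
      a *: map_mx (@complex.Re K) w - b *: map_mx (@complex.Im K) w.
    have := congr1 (map_mx (@complex.Re K)) wa; move/matrixP => h.
    apply/matrixP => k j; move: (h k j); rewrite !mxE.
    (* [Rcomplex K] is K[i] seen as a real vector space, on which taking the real part is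
       additive. *)
    rewrite (raddf_sum (@complex.Re K : Rcomplex K -> K)) => e.
    rewrite (eq_bigr (fun l => complex.Re (w k l * toC _ _ (A' i) l j))) ?e.
      by case: (w k j) => ? ? /=.
    by move=> l _; rewrite !mxE; case: (w k l) => ? ? /=; rewrite mulr0 subr0.
  have him : map_mx (@complex.Im K) w *m A' i =
      b *: map_mx (@complex.Re K) w + a *: map_mx (@complex.Im K) w.
    have := congr1 (map_mx (@complex.Im K)) wa; move/matrixP => h.
    apply/matrixP => k j; move: (h k j); rewrite !mxE.
    rewrite (raddf_sum (@complex.Im K : Rcomplex K -> K)) => e.
    rewrite (eq_bigr (fun l => complex.Im (w k l * toC _ _ (A' i) l j))) ?e.
      by case: (w k j) => ? ? /=; rewrite addrC.
    by move=> l _; rewrite !mxE; case: (w k l) => ? ? /=; rewrite mulr0 add0r.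
  rewrite /x /y -!mulmxA -A'E !mulmxA hre him.
  by rewrite mulmxBl mulmxDl !scalemxAl.
have xy0 : (x != 0) || (y != 0).
  rewrite -negb_and; apply: contra w0 => /andP[].
  rewrite !mulmx_free_eq0 // => /eqP/matrixP hx /eqP/matrixP hy.
  apply/eqP/matrixP => k j; move: (hx k j) (hy k j); rewrite !mxE.
  by case: (w k j) => ? ? /= -> ->.
have [xU yU] : (x <= U)%MS /\ (y <= U)%MS by split; rewrite -eqBU submxMl.
clearbody x y.
(* The squared Hermitian norm of x + iy. *)
pose nrm := (x *m x^T + y *m y^T) 0 0.
have nrm_neq0 : nrm != 0.
  rewrite /nrm mxE !mulmx_tr_diag paddr_eq0 ?sumr_ge0 // => *; rewrite ?sqr_ge0 //.
  apply: contraL xy0 => /andP[/eqP hx /eqP hy].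
  rewrite negb_or !negbK; apply/andP; split; apply/eqP/mulmx_tr_eq0;
    by apply/matrixP => i j; rewrite !ord1 mulmx_tr_diag mxE.
have re i : exists a, x *m A i = a *: x /\ y *m A i = a *: y.
  have [a [b [hx hy]]] := re_im i; exists a.
  (* By symmetry of [A i], x A y' is the transpose of y A x'. Expanding both sides leaves -b yy' = b
     xx', that is, [b * nrm = 0]. *)
  have b0 : b = 0.
    have e : x *m A i *m y^T = (y *m A i *m x^T)^T.
      by rewrite !trmx_mul trmxK Asym mulmxA.
    have : b * nrm = 0.
      move: e; rewrite hx hy mulmxBl mulmxDl -!scalemxAl linearD !linearZ /=.
      rewrite !trmx_mul !trmxK /nrm [_ 0 0]mxE.
      move: (x *m x^T) (x *m y^T) (y *m y^T) => X Z Y /matrixP/(_ 0 0).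
      rewrite !mxE => /eqP; rewrite -subr_eq0 => /eqP e.
      by apply: oppr_inj; rewrite oppr0 -e; ring.
    by move/eqP; rewrite mulf_eq0 (negPf nrm_neq0) orbF => /eqP.
  by rewrite hx hy b0 !scale0r subr0 add0r.
have [c hc] : exists c, forall i, x *m A i = c i *: x /\ y *m A i = c i *: y.
  have /fin_all_exists := re; by case=> c hc; exists c.
case/orP: xy0 => h; [exists x|exists y]; exists c; split => // i; by have [] := hc i.
Qed.

(** For a basis [B] of the row space, B'(BB')^-1 B is the projector. The Gram matrix BB' is
    invertible because vBB' = 0 makes vB a row of norm zero. *)
Lemma orthogonal_projector_exists (K : realFieldType) m n (U : 'M[K]_(m, n)) :
  exists M : 'M[K]_n, [/\ M^T = M, M *m M = M & (M :=: U)%MS].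
Proof.
have [B [Bfree eqBU]] : exists B : 'M[K]_(\rank U, n), row_free B /\ (B :=: U)%MS.
  by exists (row_base U); split; [exact: row_base_free|exact: eq_row_base].
have unitG : B *m B^T \in unitmx.
  rewrite -row_free_unit; apply/inj_row_free => v vG0.
  apply/eqP; rewrite -(mulmx_free_eq0 _ Bfree); apply/eqP/mulmx_tr_eq0.
  by rewrite trmx_mul mulmxA -(mulmxA v) vG0 mul0mx.
have MU : (B^T *m invmx (B *m B^T) *m B :=: B)%MS.
  apply/eqmxP; rewrite submxMl /=; apply/submxP; exists B.
  by rewrite !mulmxA mulmxV // mul1mx.
exists (B^T *m invmx (B *m B^T) *m B); split.
- by rewrite !trmx_mul trmx_inv trmx_mul trmxK mulmxA.
- by rewrite !mulmxA -(mulmxA _ B B^T) mulmxKV.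
- exact: eqmx_trans MU eqBU.
Qed.

(** * Strata *)

Section Strata.
Variables (K : realType) (S : finType) (G : {group {perm S}}).

Lemma orbital_swap (x y : S * S) :
  ((y.2, y.1) \in orbital G (x.2, x.1)) = (y \in orbital G x).
Proof.
by apply/imsetP/imsetP => -[g gG]; case: y => y1 y2 /= [-> ->]; exists g.
Qed.

Lemma sym_orbital_mx_tr x : (sym_orbital_mx K G x)^T = sym_orbital_mx K G x.
Proof.
apply/matrixP => i j; rewrite !mxE; congr (_%:R); congr nat_of_bool.
rewrite !inE -(orbital_swap x (_ i, _ j)) -(orbital_swap x (_ j, _ i)) /=.
by rewrite orbC.
Qed.

(** The definition of a stratum speaks of single column vectors. Applied to each column it yields
    matrix identities, and transposition gives the version with [M] on the left. *)
Lemma stratum_projector_eigen (M : 'M[K]_#|S|) : is_stratum_projector G M ->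
  exists c : S * S -> K,
    [/\ forall x, sym_orbital_mx K G x *m M = c x *: M,
        forall x, M *m sym_orbital_mx K G x = c x *: M &
        forall m (U : 'M[K]_(#|S|, m)),
          (forall x, sym_orbital_mx K G x *m U = c x *: U) -> M *m U = U].
Proof.
move=> [_ Msym Midem [c cP]]; exists c.
have eq_cols m (U U' : 'M[K]_(#|S|, m)) : (forall j, col j U = col j U') -> U = U'.
  by move=> UU'; apply/matrixP => i j; have /colP/(_ i) := UU' j; rewrite !mxE.
have AM x : sym_orbital_mx K G x *m M = c x *: M.
  apply: eq_cols => j; rewrite !colE -mulmxA -scalemxAl.
  by apply: (cP (M *m delta_mx j 0)).1; exists (delta_mx j 0).
split=> // [x|m U UA].
  apply: trmx_inj.
  by rewrite trmx_mul sym_orbital_mx_tr Msym AM linearZ /= Msym.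
apply: eq_cols => j; rewrite !colE -mulmxA.
have [u ->] : exists u : 'cV[K]_#|S|, U *m delta_mx j 0 = M *m u.
  by apply: (cP _).2 => x; rewrite mulmxA UA scalemxAl.
by rewrite mulmxA Midem.
Qed.

(** The projector is the orthogonal one onto the whole common eigenspace for [c]; the vector [v]
    shows that it is nonzero. *)
Lemma stratum_projector_exists (c : S * S -> K) (v : 'cV[K]_#|S|) :
  v != 0 -> common_eigenspace G c v ->
  exists2 M, is_stratum_projector G M & M *m v = v.
Proof.
move=> v0 cv.
(* [eigenspace] consists of row vectors, strata of column vectors; symmetry of the orbital matrices
   lets transposition pass between them. *)
pose U := (\bigcap_x eigenspace (sym_orbital_mx K G x) (c x))%MS.
have UP (u : 'cV[K]_#|S|) : (u^T <= U)%MS <-> common_eigenspace G c u.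
  split=> [/sub_bigcapmxP uU x | uc].
    apply: trmx_inj; rewrite trmx_mul linearZ sym_orbital_mx_tr.
    exact/eigenspaceP/uU.
  apply/sub_bigcapmxP => x _; apply/eigenspaceP.
  by rewrite -[X in _ *m X]sym_orbital_mx_tr -trmx_mul uc linearZ.
have [M [Msym Midem eqMU]] := orthogonal_projector_exists U.
have MP (u : 'cV[K]_#|S|) : (exists w, u = M *m w) <-> common_eigenspace G c u.
  rewrite -UP -eqMU; split=> [[w ->]|/submxP[w uE]].
    by rewrite trmx_mul Msym submxMl.
  by exists w^T; rewrite -[u]trmxK uE trmx_mul Msym.
have Mv : M *m v = v by have /MP[w ->] := cv; rewrite mulmxA Midem.
exists M => //; split=> //; last by exists c.
by apply: contraNneq v0 => M0; rewrite -Mv M0 mul0mx.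
Qed.

Variables (I : finType) (P : I -> 'M[K]_#|S|).
Hypothesis P_strata : stratum_projectors G P.

Let P_stratum i : is_stratum_projector G (P i).
Proof. by apply/P_strata.2; exists i. Qed.

(** If two strata have the same eigenvalues, each projector fixes the range of the other, so by
    symmetry they coincide, against injectivity of [P]. Otherwise some orbital matrix has distinct
    eigenvalues on them, which kills the product. *)
Lemma stratum_projectors_orthogonal : orthogonal_idempotents P.
Proof.
split=> [i|i|i|i j ij]; try by have [] := P_stratum i.
have [ci [Ai iA ciP]] := stratum_projector_eigen (P_stratum i).
have [cj [Aj jA cjP]] := stratum_projector_eigen (P_stratum j).
have [cE|] := boolP [forall x, ci x == cj x].
  have {}cE x : ci x = cj x by apply/eqP/(forallP cE).
  have PjPi : P j *m P i = P i by apply: cjP => x; rewrite Ai cE.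
  have PiPj : P i *m P j = P j by apply: ciP => x; rewrite Aj cE.
  have [_ isym _ _] := P_stratum i; have [_ jsym _ _] := P_stratum j.
  by move/eqP: ij; case; apply: P_strata.1; rewrite -PjPi -jsym -isym -trmx_mul PiPj.
rewrite negb_forall => /existsP[x cij].
apply/eqP; have : (ci x - cj x) *: (P i *m P j) == 0.
  by rewrite scalerBl scalemxAl -iA scalemxAr -Aj mulmxA subrr.
by rewrite scaler_eq0 subr_eq0 (negPf cij).
Qed.

Hypothesis G_stratifiable : stratifiable K G.

(* Otherwise the range of 1 - sum P, invariant under the orbital matrices, would
   contain a common eigenvector, which some stratum projector fixes. *)
Lemma sum_stratum_projectors : \sum_i P i = 1%:M.
Proof.
have [_ Psym Pidem Porth] := stratum_projectors_orthogonal.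
set E := \sum_i P i.
have PE i : E *m P i = P i.
  rewrite mulmx_suml (bigD1 i) //= Pidem big1 ?addr0 // => j ji; exact: Porth.
have Esym : E^T = E by rewrite linear_sum; apply: eq_bigr => i _; exact: Psym.
have EE : E *m E = E by rewrite {2}/E mulmx_sumr; apply: eq_bigr => i _; exact: PE.
have EA x : E *m sym_orbital_mx K G x = sym_orbital_mx K G x *m E.
  rewrite mulmx_sumr mulmx_suml; apply: eq_bigr => i _.
  by have [c [-> ->]] := stratum_projector_eigen (P_stratum i).
apply/eqP; rewrite eq_sym -subr_eq0; apply/negPn/negP => F0.
have Fstab x : stablemx (1%:M - E) (sym_orbital_mx K G x).
  apply/submxP; exists (sym_orbital_mx K G x).
  by rewrite mulmxBl mulmxBr mulmx1 mul1mx EA.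
have [v [c [v0 vF vA]]] := symmetric_common_eigenvector
  sym_orbital_mx_tr G_stratifiable Fstab F0.
have vE : v *m E = 0.
  by have /submxP[u ->] := vF; rewrite -mulmxA mulmxBl EE mul1mx subrr mulmx0.
have [M M_stratum Mv] : exists2 M, is_stratum_projector G M & M *m v^T = v^T.
  apply: (@stratum_projector_exists c); first by rewrite trmx_eq0.
  move=> x; apply: trmx_inj.
  by rewrite trmx_mul linearZ /= trmxK sym_orbital_mx_tr.
(* Now v = v P_i = v E P_i = 0, a contradiction. *)
have /P_strata.2[i Mi] := M_stratum.
move/eqP: v0; apply; apply: trmx_inj; rewrite -Mv Mi -(Psym i) -trmx_mul.
by rewrite -(PE i) mulmxA vE mul0mx.
Qed.

End Strata.

(** * Covariance matrices *)

Section Covariance.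
Context d (T : measurableType d) (K : realType) (Pr : probability T K).

Let Pr_fin : Pr setT \is a fin_num := fin_num_measure Pr _ measurableT.

Lemma Lfun2_Lfun1 (X : T -> K) : X \in Lfun Pr 2%:E -> X \in Lfun Pr 1.
Proof. exact: Lfun_subset12. Qed.

(* The joint law is the product of the marginal laws, so Fubini applies. *)
Lemma expectationM_independent (X Y : T -> K) :
  X \in Lfun Pr 1 -> Y \in Lfun Pr 1 -> X \* Y \in Lfun Pr 1 ->
  (forall A B, measurable A -> measurable B ->
     Pr (X @^-1` A `&` Y @^-1` B)%classic =
       (Pr (X @^-1` A)%classic * Pr (Y @^-1` B)%classic)%E) ->
  ('E_Pr[X \* Y] = 'E_Pr[X] * 'E_Pr[Y])%E.
Proof.
move=> X1 Y1 XY1 XYindep.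
have mX : measurable_fun setT X by move: X1; rewrite inE => /andP[/[!inE]].
have mY : measurable_fun setT Y by move: Y1; rewrite inE => /andP[/[!inE]].
pose mX' := isMeasurableFun.Build _ _ _ _ X mX.
pose X' : {mfun T >-> K} := HB.pack X mX'.
pose mY' := isMeasurableFun.Build _ _ _ _ Y mY.
pose Y' : {mfun T >-> K} := HB.pack Y mY'.
pose mXY' := isMeasurableFun.Build _ _ _ _ _ (measurable_fun_pair mX mY).
pose XY' : {mfun T >-> (K * K)%type} := HB.pack (fun t => (X t, Y t)) mXY'.
pose g (z : K * K) := (z.1 * z.2)%:E.
have mg : measurable_fun setT g.
  by apply/measurable_EFinP; exact: measurable_funM.
(* Independence gives the equality on rectangles, and uniqueness of the product measure extends it
   to all measurable sets. *)
have prodE A : measurable A ->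
    (distribution Pr X' \x distribution Pr Y')%E A = distribution Pr XY' A.
  apply: product_measure_unique => B C mB mC.
  exact: XYindep.
have gint : (distribution Pr X' \x distribution Pr Y')%E.-integrable setT g.
  have /integrableP[_ h] : (distribution Pr XY').-integrable setT g.
    apply: integrable_pushforward => //; exact/Lfun1_integrable.
  apply/integrableP; split => //.
  rewrite (eq_measure_integral (distribution Pr XY')) // => A mA _.
  exact: prodE.
have -> : ('E_Pr[X \* Y] = \int[distribution Pr XY']_z g z)%E.
  by rewrite unlock integral_distribution //; exact/Lfun1_integrable.
have -> : ('E_Pr[Y] = \int[distribution Pr Y']_y y%:E)%E.
  by rewrite unlock integral_distribution //; exact/Lfun1_integrable.
have Yint : (distribution Pr Y').-integrable setT (EFin : K -> \bar K).
  apply: integrable_pushforward => //; exact/Lfun1_integrable.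
have Xint : (distribution Pr X').-integrable setT (EFin : K -> \bar K).
  apply: integrable_pushforward => //; exact/Lfun1_integrable.
have -> : ('E_Pr[X] = \int[distribution Pr X']_x x%:E)%E.
  by rewrite unlock integral_distribution //; exact/Lfun1_integrable.
rewrite (eq_measure_integral (distribution Pr X' \x distribution Pr Y')%E); last first.
  by move=> A mA _; apply/esym/prodE.
rewrite -integral12_prod_meas1 // /fubini_F /g /=.
under eq_integral do under eq_integral do rewrite EFinM.
under eq_integral do rewrite integralZl //.
have fY : (\int[distribution Pr Y']_y y%:E)%E \is a fin_num by exact: integrable_fin_num.
by rewrite -(fineK fY) integralZr.
Qed.

Lemma covariance_fin_num2 (X Y : T -> K) :
  X \in Lfun Pr 2%:E -> Y \in Lfun Pr 2%:E -> covariance Pr X Y \is a fin_num.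
Proof.
move=> X2 Y2; apply: covariance_fin_num; try exact: Lfun2_Lfun1.
exact: Lfun2_mul_Lfun1.
Qed.

Lemma covariance_independent (X Y : T -> K) :
  X \in Lfun Pr 2%:E -> Y \in Lfun Pr 2%:E ->
  (forall A B, measurable A -> measurable B ->
     Pr (X @^-1` A `&` Y @^-1` B)%classic =
       (Pr (X @^-1` A)%classic * Pr (Y @^-1` B)%classic)%E) ->
  covariance Pr X Y = 0%E.
Proof.
move=> X2 Y2 XYindep; have XY1 := Lfun2_mul_Lfun1 X2 Y2.
have [X1 Y1] := (Lfun2_Lfun1 X2, Lfun2_Lfun1 Y2).
rewrite covarianceE // expectationM_independent // subee //.
by rewrite fin_numM ?expectation_fin_num.
Qed.

(** Both claims go through one induction: additivity of [fine] needs finite covariances, hence a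
    square-integrable tail of the sum. *)
Lemma fine_covariance_suml (I : Type) (s : seq I) (a : I -> K)
    (X : I -> T -> K) (Y : T -> K) :
  (forall i, X i \in Lfun Pr 2%:E) -> Y \in Lfun Pr 2%:E ->
  (\sum_(i <- s) (a i \o* X i) : T -> K) \in Lfun Pr 2%:E /\
  fine (covariance Pr (\sum_(i <- s) (a i \o* X i) : T -> K) Y) =
    \sum_(i <- s) a i * fine (covariance Pr (X i) Y).
Proof.
move=> X2 Y2; elim: s => [|i s [IH2 IHs]].
  rewrite !big_nil; split; first exact: Lfun_cst.
  by rewrite -[0]/(cst 0) covariance_cst_l.
have aX2 : (a i \o* X i) \in Lfun Pr 2%:E by rewrite Lfun_scale ?ler1n.
have XY1 j := Lfun2_mul_Lfun1 (X2 j) Y2.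
have [X1 Y1] := (fun j => Lfun2_Lfun1 (X2 j), Lfun2_Lfun1 Y2).
rewrite !big_cons; split; first by rewrite rpredD ?lee1n.
rewrite covarianceDl // fineD ?IHs; last 2 first.
- exact: covariance_fin_num2.
- exact: covariance_fin_num2.
by rewrite (covarianceZl _ (X1 i) Y1 (XY1 i)) fineM ?covariance_fin_num2.
Qed.

(** For [Y := X] this is [cov_mx] by conversion. Two separate arguments allow linearity to be proved
    on the left only and moved to the right by transposition. *)
Definition cross_cov_mx m n (X : T -> 'cV[K]_m) (Y : T -> 'cV[K]_n) : 'M[K]_(m, n) :=
  \matrix_(i, j) fine (covariance Pr (Defs.coord X i) (Defs.coord Y j)).

Lemma cross_cov_mx_tr m n (X : T -> 'cV[K]_m) (Y : T -> 'cV[K]_n) :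
  (cross_cov_mx X Y)^T = cross_cov_mx Y X.
Proof. by apply/matrixP => i j; rewrite !mxE covarianceC. Qed.

Lemma coord_mulmx m n (A : 'M[K]_(m, n)) (X : T -> 'cV[K]_n) i :
  Defs.coord (fun t => A *m X t) i = \sum_j (A i j \o* Defs.coord X j).
Proof.
apply/funext => t; rewrite /Defs.coord mxE fct_sumE.
by apply: eq_bigr => j _ /=; rewrite mulrC.
Qed.

Lemma square_integrable_mulmx m n (A : 'M[K]_(m, n)) (X : T -> 'cV[K]_n) :
  square_integrable Pr X -> square_integrable Pr (fun t => A *m X t).
Proof.
move=> X2 i; rewrite coord_mulmx.
have [] // := @fine_covariance_suml _ (index_enum 'I_n) (A i) (Defs.coord X) (cst 0).
exact: Lfun_cst.
Qed.

Lemma square_integrable_add n (X Y : T -> 'cV[K]_n) :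
  square_integrable Pr X -> square_integrable Pr Y ->
  square_integrable Pr (fun t => X t + Y t).
Proof.
move=> X2 Y2 i.
have -> : Defs.coord (fun t => X t + Y t) i = Defs.coord X i \+ Defs.coord Y i.
  by apply/funext => t; rewrite /Defs.coord mxE.
by rewrite rpredD ?lee1n.
Qed.

Lemma square_integrable_cst n (u : 'cV[K]_n) : square_integrable Pr (cst u).
Proof. move=> i; exact: Lfun_cst. Qed.

Lemma cross_cov_mx_mull m n p (A : 'M[K]_(m, n)) (X : T -> 'cV[K]_n) (Y : T -> 'cV[K]_p) :
  square_integrable Pr X -> square_integrable Pr Y ->
  cross_cov_mx (fun t => A *m X t) Y = A *m cross_cov_mx X Y.
Proof.
move=> X2 Y2; apply/matrixP => i j; rewrite !mxE coord_mulmx.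
have [_ ->] := fine_covariance_suml (index_enum 'I_n) (A i) X2 (Y2 j).
by apply: eq_bigr => k _; rewrite mxE.
Qed.

Lemma cross_cov_mx_addl m n (X X' : T -> 'cV[K]_m) (Y : T -> 'cV[K]_n) :
  square_integrable Pr X -> square_integrable Pr X' -> square_integrable Pr Y ->
  cross_cov_mx (fun t => X t + X' t) Y = cross_cov_mx X Y + cross_cov_mx X' Y.
Proof.
move=> X2 X'2 Y2; apply/matrixP => i j; rewrite !mxE.
have -> : Defs.coord (fun t => X t + X' t) i = Defs.coord X i \+ Defs.coord X' i.
  by apply/funext => t; rewrite /Defs.coord mxE.
rewrite covarianceDl // fineD //.
- exact: covariance_fin_num2.
- exact: covariance_fin_num2.
Qed.

Lemma cov_mx_mulmx m n (A : 'M[K]_(m, n)) (X : T -> 'cV[K]_n) :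
  square_integrable Pr X ->
  cov_mx Pr (fun t => A *m X t) = A *m cov_mx Pr X *m A^T.
Proof.
move=> X2; have AX2 := square_integrable_mulmx A X2.
rewrite -[LHS]/(cross_cov_mx _ _) cross_cov_mx_mull // -mulmxA; congr (_ *m _).
by rewrite -cross_cov_mx_tr cross_cov_mx_mull // trmx_mul cross_cov_mx_tr.
Qed.

Lemma cov_mx_add n (X Y : T -> 'cV[K]_n) :
  square_integrable Pr X -> square_integrable Pr Y -> cross_cov_mx X Y = 0 ->
  cov_mx Pr (fun t => X t + Y t) = cov_mx Pr X + cov_mx Pr Y.
Proof.
move=> X2 Y2 XY0; have XY2 := square_integrable_add X2 Y2.
rewrite -[LHS]/(cross_cov_mx _ _) cross_cov_mx_addl //.
rewrite -[cross_cov_mx X _]cross_cov_mx_tr -[cross_cov_mx Y _]cross_cov_mx_tr.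
rewrite !cross_cov_mx_addl // !linearD /= !cross_cov_mx_tr.
by rewrite -[cross_cov_mx Y X]cross_cov_mx_tr XY0 trmx0 addr0 add0r.
Qed.

Lemma cross_cov_mx_cst m n (X : T -> 'cV[K]_m) (u : 'cV[K]_n) :
  cross_cov_mx X (cst u) = 0.
Proof.
apply/matrixP => i j; rewrite !mxE -[Defs.coord (cst u) j]/(cst (u j 0)).
by rewrite covariance_cst_r.
Qed.

Lemma cross_cov_mx_independent m n (X : T -> 'cV[K]_m) (Y : T -> 'cV[K]_n) :
  square_integrable Pr X -> square_integrable Pr Y -> independent_vectors Pr X Y ->
  cross_cov_mx X Y = 0.
Proof.
move=> X2 Y2 XY; apply/matrixP => i j; rewrite !mxE covariance_independent //.
(* Events about one coordinate are among the generators of the sigma-algebra of the whole vector. *)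
have in_sigma k (Z : T -> 'cV[K]_k) l A : measurable A ->
    g_sigma_preimage (Defs.coord Z) (Defs.coord Z l @^-1` A)%classic.
  move=> mA; apply: sub_sigma_algebra; rewrite (bigD1 l) //=; left.
  by exists A => //; rewrite setTI.
by move=> A B mA mB; apply: XY; exact: in_sigma.
Qed.

End Covariance.

(** * Balanced families of idempotents *)

Section MoorePenrose.
Variable K : realType.

(** Transposing AB = (AC)(AB) between symmetric factors gives AB = (AB)(AC) = AC, and likewise BA =
    CA. Hence B = BAB = CAC = C. *)
Lemma is_moore_penrose_unique m n (A : 'M[K]_(m, n)) (B C : 'M[K]_(n, m)) :
  is_moore_penrose A B -> is_moore_penrose A C -> B = C.
Proof.
move=> [ABA BAB ABs BAs] [ACA CAC ACs CAs].
have ABAC : A *m B = A *m C.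
  have e : A *m B = A *m C *m (A *m B) by rewrite mulmxA ACA.
  by rewrite -ABs e trmx_mul ABs ACs mulmxA ABA.
have BACA : B *m A = C *m A.
  have e : B *m A = B *m A *m (C *m A) by rewrite mulmxA -!(mulmxA B) ACA.
  by rewrite -BAs e trmx_mul BAs CAs -!mulmxA (mulmxA A B) ABA.
by rewrite -BAB -mulmxA ABAC mulmxA BACA.
Qed.

Lemma moore_penroseE m n (A : 'M[K]_(m, n)) (B : 'M[K]_(n, m)) :
  is_moore_penrose A B -> moore_penrose A = B.
Proof.
move=> mpB; apply: xget_unique => // C mpC; exact: is_moore_penrose_unique mpC mpB.
Qed.

Lemma moore_penrose_scale_projector n (a : K) (R : 'M[K]_n) :
  a != 0 -> R^T = R -> R *m R = R -> moore_penrose (a *: R) = a^-1 *: R.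
Proof.
move=> a0 Rsym Ridem; apply: moore_penroseE.
have aR : a *: R *m (a^-1 *: R) = R.
  by rewrite -scalemxAl -scalemxAr Ridem scalerA divff // scale1r.
have Ra : a^-1 *: R *m (a *: R) = R.
  by rewrite -scalemxAl -scalemxAr Ridem scalerA mulVf // scale1r.
by split; rewrite ?aR ?Ra // -scalemxAr Ridem.
Qed.

End MoorePenrose.

(** A vanishing sum of nonnegative terms would make every [lambda i] zero, contradicting total
    weight 1. *)
Lemma convex_sum_gt0 (K : realFieldType) (I : finType) (lambda w : I -> K) :
  (forall i, 0 <= lambda i) -> \sum_i lambda i = 1 -> (forall i, 0 < w i) ->
  0 < \sum_i lambda i * w i.
Proof.
move=> l0 l1 w0.
have lw0 i : 0 <= lambda i * w i by rewrite mulr_ge0 // ltW.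
rewrite lt0r sumr_ge0 // andbT; apply/negP; rewrite psumr_eq0 // => /allP lw.
have : \sum_i lambda i == 0.
  rewrite big1 // => i _; apply/eqP; have := lw i (mem_index_enum i).
  by rewrite /= mulf_eq0 (gt_eqF (w0 i)) orbF.
by rewrite l1 oner_eq0.
Qed.

(** Compare a diagonal entry: [S i i] is the squared norm of row i of S, positive for some i, and
    that of SMS is the squared norm of row i of SM. *)
Lemma projector_sandwich_ge0 (K : realFieldType) n (S M : 'M[K]_n) (lambda : K) :
  S != 0 -> S^T = S -> S *m S = S -> M^T = M -> M *m M = M ->
  S *m M *m S = lambda *: S -> 0 <= lambda.
Proof.
move=> S0 Ssym Sidem Msym Midem SMS.
have [i Sii] : exists i, S i i != 0.
  apply/existsP; apply: contraNT S0; rewrite negb_exists => /forallP S0.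
  apply/eqP/mulmx_tr_eq0; rewrite Ssym Sidem; apply/matrixP => i j.
  have : S i i == 0 by apply/negbNE/S0.
  rewrite -Sidem -{2}Ssym mulmx_tr_diag psumr_eq0 => [/allP /(_ j)|k _];
    last exact: sqr_ge0.
  by rewrite mem_index_enum sqrf_eq0 Sidem mxE => /(_ isT) /eqP.
have Sii_gt0 : 0 < S i i.
  by rewrite lt0r Sii -Sidem -{2}Ssym mulmx_tr_diag sumr_ge0 // => j _; exact: sqr_ge0.
have : 0 <= (lambda *: S) i i.
  rewrite -SMS -Midem -{2}Msym -{2}Ssym mulmxA -(mulmxA (S *m M)) -trmx_mul.
  by rewrite mulmx_tr_diag sumr_ge0 // => j _; exact: sqr_ge0.
by rewrite mxE pmulr_lge0.
Qed.

Lemma orthogonal_idempotents_sum_mul (K : realType) n (I : finType)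
    (P : I -> 'M[K]_n) : orthogonal_idempotents P ->
  (forall i, P i *m (\sum_j P j) = P i) /\ (forall i, (\sum_j P j) *m P i = P i).
Proof.
move=> [_ _ Pidem Porth]; split=> i.
  rewrite mulmx_sumr (bigD1 i) //= Pidem big1 ?addr0 // => j ji.
  by rewrite Porth // eq_sym.
by rewrite mulmx_suml (bigD1 i) //= Pidem big1 ?addr0 // => j ji; rewrite Porth.
Qed.

(** Right multiplication by [Q j] absorbs the sum in the balance equation. Summing the resulting
    sandwiches over i gives [Q j] back, so the coefficients add up to 1. *)
Lemma structure_balanced_coef (K : realType) n (I J : finType)
    (P : I -> 'M[K]_n) (Q : J -> 'M[K]_n) (lambda : I -> J -> K) :
  orthogonal_idempotents P -> orthogonal_idempotents Q ->
  (forall j, (\sum_i P i) *m Q j = Q j) -> structure_balanced P Q lambda ->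
  [/\ forall i j, Q j *m P i *m Q j = lambda i j *: Q j,
      forall i j, 0 <= lambda i j & forall j, \sum_i lambda i j = 1].
Proof.
move=> [_ Psym Pidem _] [Q0 Qsym Qidem Qorth] PQ bal.
have QPQ i j : Q j *m P i *m Q j = lambda i j *: Q j.
  have [_ SQ] := orthogonal_idempotents_sum_mul (And4 Q0 Qsym Qidem Qorth).
  have := congr1 (mulmx^~ (Q j)) (bal i j).
  by rewrite -mulmxA SQ -scalemxAl Qidem.
split=> // [i j|j].
  exact: projector_sandwich_ge0 (Q0 j) (Qsym j) (Qidem j) (Psym i) (Pidem i) (QPQ i j).
apply/eqP; rewrite -subr_eq0; have : (\sum_i lambda i j - 1) *: Q j == 0.
  rewrite scalerBl scale1r scaler_suml -(eq_bigr _ (fun i _ => QPQ i j)).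
  by rewrite -mulmx_suml -mulmx_sumr -mulmxA PQ Qidem subrr.
by rewrite scaler_eq0 (negPf (Q0 j)) orbF.
Qed.

(** * Inversion of the covariance matrix *)

Section Inverse.
Variables (K : realType) (n : nat) (IP IQ : finType).
Variables (P : IP -> 'M[K]_n) (Q : IQ -> 'M[K]_n) (lambda : IP -> IQ -> K).
Variables (xi : IP -> K) (rho : K) (eta : IQ -> K).
Hypothesis P_idempotents : orthogonal_idempotents P.
Hypothesis P_sum : \sum_p P p = 1%:M.
Hypothesis Q_idempotents : orthogonal_idempotents Q.
Hypothesis PQ_balanced : structure_balanced P Q lambda.
Hypothesis xi_gt0 : forall p, 0 < xi p.
Hypothesis rho_eta_ge0 : forall q, 0 <= rho * eta q.

Definition alpha_coef q := \sum_p lambda p q / xi p.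
Local Notation alpha := alpha_coef.
Local Notation c q := (1 + rho * eta q * alpha q).
Definition cov_sum := \sum_p xi p *: P p + rho *: \sum_q eta q *: Q q.
(** The matrix called A in the opening outline; it is the inverse of the sum of the
    [xi p *: P p]. *)
Local Notation B := (\sum_p (xi p)^-1 *: P p).
Definition inv_cov_sum := \sum_p (xi p)^-1 *: P p -
  \sum_p \sum_q \sum_p'
    (rho * eta q / c q * (xi p * xi p')^-1) *: (P p *m Q q *m P p').

Lemma alpha_coef_gt0 q : 0 < alpha q.
Proof.
have [|_ l0 l1] := structure_balanced_coef P_idempotents Q_idempotents _ PQ_balanced.
  by move=> j; rewrite P_sum mul1mx.
by apply: convex_sum_gt0 => // p; rewrite invr_gt0.
Qed.

Lemma one_add_alpha_gt0 q : 0 < c q.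
Proof. by rewrite ltr_pwDl // mulr_ge0 // ltW // alpha_coef_gt0. Qed.

Lemma balanced_inv_mul q : Q q *m B *m (\sum_q Q q) = alpha q *: Q q.
Proof.
rewrite [Q q *m _]mulmx_sumr mulmx_suml scaler_suml; apply: eq_bigr => p _.
by rewrite -scalemxAr -scalemxAl PQ_balanced scalerA mulrC.
Qed.

Lemma inv_cov_sumE :
  inv_cov_sum = B - \sum_q (rho * eta q / c q) *: (B *m Q q *m B).
Proof.
congr (_ - _); rewrite exchange_big; apply: eq_bigr => q _.
rewrite mulmx_suml mulmx_suml scaler_sumr; apply: eq_bigr => p _.
rewrite mulmx_sumr scaler_sumr; apply: eq_bigr => p' _.
by rewrite -!(scalemxAl, scalemxAr) !scalerA invfM mulrA.
Qed.

(** Only the term of index [q] in the correction survives, and 1 - (rho eta / c) alpha = 1 / c. *)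
Lemma mul_inv_cov_sum q : Q q *m inv_cov_sum = (c q)^-1 *: (Q q *m B).
Proof.
have [_ QS] := orthogonal_idempotents_sum_mul Q_idempotents.
have [_ _ Qidem Qorth] := Q_idempotents.
(* Writing [Q q'] as I_Q [Q q'] places [B] between [Q q] and I_Q, where balance applies. *)
have QBQ q' : Q q *m (B *m Q q' *m B) = alpha q *: (Q q *m Q q' *m B).
  by rewrite -[in LHS](QS q') !mulmxA balanced_inv_mul -!scalemxAl.
rewrite inv_cov_sumE mulmxBr [X in _ - X]mulmx_sumr [X in _ - X](bigD1 q) //=
  [X in _ - (_ + X)]big1 ?addr0 => [|q' q'q].
  rewrite -scalemxAr QBQ Qidem scalerA -[X in X - _]scale1r -scalerBl.
  congr (_ *: _); have := lt0r_neq0 (one_add_alpha_gt0 q) => c0.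
  by field.
by rewrite -scalemxAr QBQ Qorth 1?eq_sym // mul0mx !scaler0.
Qed.

(** The [P] part of V cancels the left [B] in each B Q B, leaving minus the sum of (rho eta / c) Q
    B. By [mul_inv_cov_sum] the [Q] part contributes the same sum with a plus sign. *)
Lemma cov_sumV : cov_sum *m inv_cov_sum = 1%:M.
Proof.
have [_ _ Pidem Porth] := P_idempotents.
have AB : (\sum_p xi p *: P p) *m B = 1%:M.
  rewrite -P_sum mulmx_suml; apply: eq_bigr => p _.
  rewrite mulmx_sumr (bigD1 p) //= big1 ?addr0 => [|p' p'p].
    by rewrite -scalemxAl -scalemxAr Pidem scalerA divff ?scale1r ?lt0r_neq0.
  by rewrite -scalemxAl -scalemxAr Porth 1?eq_sym // !scaler0.
rewrite mulmxDl -scalemxAl [X in _ + _ *: X]mulmx_suml.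
rewrite inv_cov_sumE mulmxBr AB -inv_cov_sumE -addrA.
rewrite [X in _ + X](_ : _ = 0) ?addr0 // mulmx_sumr addrC; apply/eqP.
rewrite subr_eq0 scaler_sumr; apply/eqP/eq_bigr => q _.
rewrite -scalemxAl mul_inv_cov_sum -scalemxAr !mulmxA AB mul1mx.
by rewrite !scalerA.
Qed.

Lemma cov_sum_unit : cov_sum \in unitmx.
Proof. by have [] := mulmx1_unit cov_sumV. Qed.

Lemma invmx_cov_sum : invmx cov_sum = inv_cov_sum.
Proof. by rewrite -[RHS](mulKmx cov_sum_unit) cov_sumV mulmx1. Qed.

Lemma cov_sum_tr : cov_sum^T = cov_sum.
Proof.
have [_ Psym _ _] := P_idempotents; have [_ Qsym _ _] := Q_idempotents.
rewrite /cov_sum linearD linearZ /=; congr (_ + _ *: _); rewrite linear_sum.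
  by apply: eq_bigr => p _; rewrite linearZ /= Psym.
by apply: eq_bigr => q _; rewrite linearZ /= Qsym.
Qed.

Variables (IR : finType) (R : IR -> 'M[K]_n) (lambdaR : IQ -> IR -> K).
Hypothesis R_idempotents : orthogonal_idempotents R.
Hypothesis QR : forall i, (\sum_q Q q) *m R i = R i.
Hypothesis QR_balanced : structure_balanced Q R lambdaR.

Definition theta_coef i := \sum_q alpha q * lambdaR q i * (c q)^-1.

Lemma theta_coef_gt0 i : 0 < theta_coef i.
Proof.
have [_ l0 l1] := structure_balanced_coef Q_idempotents R_idempotents QR QR_balanced.
rewrite /theta_coef; under eq_bigr do rewrite mulrAC mulrC.
by apply: convex_sum_gt0 => // q; rewrite divr_gt0 ?alpha_coef_gt0 ?one_add_alpha_gt0.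
Qed.

Lemma R_mul_sum i : R i *m (\sum_q Q q) = R i.
Proof.
have [_ Rsym _ _] := R_idempotents; have [_ Qsym _ _] := Q_idempotents.
apply: trmx_inj; rewrite trmx_mul Rsym linear_sum -[RHS]QR.
by congr (_ *m _); apply: eq_bigr => q _; exact: Qsym.
Qed.

Lemma R_mul_inv_cov_sum i :
  R i *m inv_cov_sum = \sum_q (c q)^-1 *: (R i *m Q q *m B).
Proof.
rewrite -[in LHS](R_mul_sum i) mulmx_sumr mulmx_suml; apply: eq_bigr => q _.
by rewrite -mulmxA mul_inv_cov_sum -scalemxAr mulmxA.
Qed.

Lemma R_mul_inv_cov_sum_expand i :
  R i *m inv_cov_sum =
  \sum_p \sum_q ((xi p)^-1 * (c q)^-1) *: (R i *m Q q *m P p).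
Proof.
rewrite R_mul_inv_cov_sum exchange_big; apply: eq_bigr => q _ /=.
rewrite mulmx_sumr scaler_sumr; apply: eq_bigr => p _.
by rewrite -scalemxAr scalerA mulrC.
Qed.

(** Inserting I_Q before the last [R i] gives R Q B R = R Q B I_Q R = alpha R Q R, and balance of
    [R] against [Q] turns R Q R into a multiple of R. *)
Lemma R_inv_cov_sum_R i : R i *m inv_cov_sum *m R i = theta_coef i *: R i.
Proof.
have [RQR _ _] := structure_balanced_coef Q_idempotents R_idempotents QR QR_balanced.
rewrite R_mul_inv_cov_sum mulmx_suml scaler_suml; apply: eq_bigr => q _.
rewrite -{2}QR -scalemxAl -!mulmxA (mulmxA B) (mulmxA (Q q)) (mulmxA (Q q)).
rewrite balanced_inv_mul -scalemxAl -scalemxAr mulmxA RQR !scalerA.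
by congr (_ *: _); ring.
Qed.

End Inverse.

(** * Lifting matrices from the second set to the first *)

Section Lift.
Variables (K : realType) (Omega Upsilon : finType) (f : Omega -> Upsilon) (r : nat).
Hypothesis f_equireplicate : forall u, #|[set w | f w == u]| = r.
Local Notation X := (design_mx K f).

(** The factor 1/r cancels X'X = r I, so that lifting respects products. *)
Definition lift_mx (M : 'M[K]_#|Upsilon|) : 'M[K]_#|Omega| :=
  r%:R^-1 *: (X *m M *m X^T).

(** Entry (i, j) counts the points that [f] sends to both i and j: a whole fibre on the diagonal,
    none off it. *)
Lemma design_mx_gram : X^T *m X = r%:R%:M.
Proof.
apply/matrixP => i j; rewrite !mxE.
pose F w : K := ((f w == enum_val i) && (f w == enum_val j))%:R.
have -> : \sum_k X^T i k * X k j = \sum_(w in Omega) F w.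
  by rewrite [RHS]big_enum_val; apply: eq_bigr => k _; rewrite !mxE -natrM mulnb.
rewrite /F -natr_sum; have [->|ij] := eqVneq i j.
  rewrite mulr1n -(f_equireplicate (enum_val j)) -sum1dep_card; congr (_%:R).
  by rewrite [RHS]big_mkcond; apply: eq_big => // w _; rewrite andbb; case: eqP.
rewrite mulr0n big1 // => w _; apply/eqP; rewrite eqb0.
by apply: contra ij => /andP[/eqP-> /eqP/enum_val_inj->].
Qed.

Hypothesis r_neq0 : r%:R != 0 :> K.

Lemma lift_mxM M N : lift_mx M *m lift_mx N = lift_mx (M *m N).
Proof.
rewrite /lift_mx -scalemxAl -scalemxAr scalerA -!mulmxA (mulmxA X^T X).
by rewrite design_mx_gram mul_scalar_mx -!scalemxAr scalerA mulfVK.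
Qed.

Lemma lift_mx_tr M : (lift_mx M)^T = lift_mx M^T.
Proof. by rewrite /lift_mx linearZ /= !trmx_mul trmxK mulmxA. Qed.

Lemma lift_mx_eq0 M : lift_mx M = 0 -> M = 0.
Proof.
move=> M0; have : X^T *m lift_mx M *m X = r%:R *: M.
  rewrite /lift_mx -scalemxAr -scalemxAl -!mulmxA design_mx_gram !mulmxA.
  rewrite design_mx_gram mul_scalar_mx mul_mx_scalar !scalerA.
  by rewrite mulVf // mul1r.
by rewrite M0 mulmx0 mul0mx => /esym/eqP; rewrite scaler_eq0 (negPf r_neq0) => /eqP.
Qed.

Lemma lift_mx_sum (I : finType) (M : I -> 'M[K]_#|Upsilon|) :
  \sum_i lift_mx (M i) = lift_mx (\sum_i M i).
Proof. by rewrite /lift_mx mulmx_sumr mulmx_suml scaler_sumr. Qed.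

End Lift.

Section OrthogonalLift.
Variables (K : realType) (Omega Upsilon : finType) (f : Omega -> Upsilon) (r : nat).
Hypothesis f_surj : forall u, exists w, f w = u.
Hypothesis f_equireplicate : forall u, #|[set w | f w == u]| = r.

(** A nonzero [M] certifies that [Upsilon] is nonempty; for empty [Upsilon] equireplication holds
    vacuously and leaves [r] arbitrary. *)
Lemma replication_neq0 (M : 'M[K]_#|Upsilon|) : M != 0 -> r%:R != 0 :> K.
Proof.
move=> M0; rewrite pnatr_eq0.
have [u _] : exists u : Upsilon, true.
  apply/existsP; apply: contraNT M0; rewrite negb_exists => /forallP noU.
  by apply/eqP/matrixP => i; have := noU (enum_val i).
have [w fw] := f_surj u; rewrite -(f_equireplicate u) -lt0n card_gt0.
by apply/set0Pn; exists w; rewrite inE fw.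
Qed.

Lemma lift_orthogonal_idempotents (I : finType) (M : I -> 'M[K]_#|Upsilon|) :
  orthogonal_idempotents M -> orthogonal_idempotents (fun i => lift_mx f r (M i)).
Proof.
move=> [M0 Msym Midem Morth]; have r0 i := replication_neq0 (M0 i).
split=> [i|i|i|i j ij].
- by apply: contra (M0 i) => /eqP/(lift_mx_eq0 f_equireplicate (r0 i))/eqP.
- by rewrite lift_mx_tr Msym.
- by rewrite (lift_mxM f_equireplicate (r0 i)) Midem.
- rewrite (lift_mxM f_equireplicate (r0 i)) Morth // /lift_mx.
  by rewrite mulmx0 mul0mx scaler0.
Qed.

End OrthogonalLift.

(** * Generalized least squares in the two-randomization model *)

Theorem mainTheorem5 (K : realType) (Omega Upsilon Gamma : finType)
  (f : Omega -> Upsilon) (h : Upsilon -> Gamma) (r : nat)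
  (f_surj : forall u, exists w, f w = u)
  (h_surj : forall g, exists u, h u = g)
  (f_equireplicate : forall u, #|[set w | f w == u]| = r)
  (G1 : {group {perm Omega}}) (G2 : {group {perm Upsilon}})
  (G1_transitive : [transitive G1, on [set: Omega] | 'P])
  (G2_transitive : [transitive G2, on [set: Upsilon] | 'P])
  (G1_stratifiable : stratifiable K G1)
  (G2_stratifiable : stratifiable K G2)
  (IP IS IQ IR : finType)
  (P : IP -> 'M[K]_#|Omega|)
  (P_strata : stratum_projectors G1 P)
  (SU : IS -> 'M[K]_#|Upsilon|)
  (SU_strata : stratum_projectors G2 SU)
  (s : IQ -> IS) (QU : IQ -> 'M[K]_#|Upsilon|)
  (QU_refinement : refinement SU s QU)
  (RU : IR -> 'M[K]_#|Upsilon|)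
  (RU_idempotents : orthogonal_idempotents RU)
  (RU_sum : \sum_i RU i =
     let Xh := design_mx K h in Xh *m invmx (Xh^T *m Xh) *m Xh^T)
  (xi : IP -> K) (eta : IQ -> K)
  (xi_gt0 : forall p, 0 < xi p)
  (eta_ge0 : forall q, 0 <= eta q)
  (eta_strata : forall q q', s q = s q' -> eta q = eta q')
  (d : measure_display) (T : measurableType d) (Pr : probability T K)
  (Z : T -> 'cV[K]_#|Omega|) (W : T -> 'cV[K]_#|Upsilon|)
  (tau : 'cV[K]_#|Gamma|)
  (Z_L2 : square_integrable Pr Z) (W_L2 : square_integrable Pr W)
  (ZW_independent : independent_vectors Pr Z W)
  (Z_mean : mean_zero Pr Z) (W_mean : mean_zero Pr W)
  (Z_cov : cov_mx Pr Z = \sum_p xi p *: P p)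
  (W_cov : cov_mx Pr W = \sum_q eta q *: QU q)
  (lambdaPQ : IP -> IQ -> K) (lambdaQR : IQ -> IR -> K) :
  let Xf := design_mx K f in
  let Xh := design_mx K h in
  let Q := fun q => r%:R^-1 *: (Xf *m QU q *m Xf^T) in
  let R := fun i => r%:R^-1 *: (Xf *m RU i *m Xf^T) in
  structure_balanced P Q lambdaPQ ->
  structure_balanced Q R lambdaQR ->
  let Y := fun t => Z t + Xf *m W t + Xf *m Xh *m tau in
  let V := cov_mx Pr Y in
  let alpha := fun q => \sum_p lambdaPQ p q / xi p in
  let theta := fun i =>
    \sum_q alpha q * lambdaQR q i * (1 + r%:R * eta q * alpha q)^-1 in
  let estimator := fun i t =>
    moore_penrose (R i *m invmx V *m R i) *m R i *m invmx V *m Y t in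
  [/\ V = \sum_p xi p *: P p + r%:R *: \sum_q eta q *: Q q,
      V \in unitmx,
      forall q, 1 + r%:R * eta q * alpha q != 0,
      invmx V = \sum_p (xi p)^-1 *: P p -
        \sum_p \sum_q \sum_p'
          (r%:R * eta q / (1 + r%:R * eta q * alpha q)
             * (xi p * xi p')^-1) *: (P p *m Q q *m P p') &
      forall i,
        [/\ theta i != 0,
            R i *m invmx V *m R i = theta i *: R i,
            forall t, estimator i t =
              (theta i)^-1 *: \sum_p \sum_q
                ((xi p)^-1 * (1 + r%:R * eta q * alpha q)^-1)
                  *: (R i *m Q q *m P p *m Y t) &
            cov_mx Pr (estimator i) = (theta i)^-1 *: R i]].

Proof.
move=> Xf Xh Q R PQ_bal QR_bal Y V alpha theta estimator.
have P_idem := stratum_projectors_orthogonal P_strata.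
have P_sum := sum_stratum_projectors P_strata G1_stratifiable.
have [QU_idem SU_QU] := QU_refinement.
(* Grouping the pieces by the stratum they refine restores the sum of the strata. *)
have QU_sum : \sum_q QU q = 1%:M.
  rewrite -(sum_stratum_projectors SU_strata G2_stratifiable).
  rewrite (partition_big s xpredT) //=; apply: eq_bigr => i _.
  by rewrite SU_QU.
have r0 (q : IQ) : r%:R != 0 :> K.
  have [QU0 _ _ _] := QU_idem.
  exact (replication_neq0 f_surj f_equireplicate (QU0 q)).
have Q_idem : orthogonal_idempotents Q.
  exact (lift_orthogonal_idempotents f_surj f_equireplicate QU_idem).
have R_idem : orthogonal_idempotents R.
  exact (lift_orthogonal_idempotents f_surj f_equireplicate RU_idempotents).
have QR i : (\sum_q Q q) *m R i = R i.
  have [RU0 _ _ _] := RU_idempotents.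
  have r0' := replication_neq0 f_surj f_equireplicate (RU0 i).
  rewrite (lift_mx_sum f r QU) (lift_mxM f_equireplicate r0').
  by rewrite QU_sum mul1mx.
have rho_eta_ge0 q : 0 <= r%:R * eta q by rewrite mulr_ge0.
(* Independence removes the cross terms and the fixed part has no covariance; X_f Cov(W) X_f' is r
   times the sum of the eta Q because each [Q q] carries 1/r. *)
have VE : V = cov_sum P Q xi r%:R eta.
  have XW2 := square_integrable_mulmx Xf W_L2.
  have ZXW0 : cross_cov_mx Pr Z (fun t => Xf *m W t) = 0.
    rewrite -cross_cov_mx_tr cross_cov_mx_mull // -cross_cov_mx_tr.
    by rewrite cross_cov_mx_independent // trmx0 mulmx0 trmx0.
  have cst_cov : cov_mx Pr (cst (Xf *m Xh *m tau)) = 0 by exact: cross_cov_mx_cst.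
  have ZXW2 := square_integrable_add Z_L2 XW2.
  have uE := cov_mx_add ZXW2 (square_integrable_cst Pr (Xf *m Xh *m tau))
    (cross_cov_mx_cst Pr _ _).
  rewrite [V]uE.
  rewrite cst_cov addr0 cov_mx_add // Z_cov cov_mx_mulmx // W_cov; congr (_ + _).
  rewrite mulmx_sumr mulmx_suml scaler_sumr; apply: eq_bigr => q _.
  by rewrite -scalemxAr -scalemxAl /Q !scalerA [r%:R * _]mulrC mulfK ?r0.
(* From here on only the idempotent and balance properties of [Q] and [R] matter, not their form as
   lifts. *)
clearbody Q R.
have V_unit : V \in unitmx.
  rewrite VE.
  exact: cov_sum_unit P_idem P_sum Q_idem PQ_bal xi_gt0 rho_eta_ge0.
have VV : invmx V = inv_cov_sum P Q lambdaPQ xi r%:R eta.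
  rewrite VE.
  exact: invmx_cov_sum P_idem P_sum Q_idem PQ_bal xi_gt0 rho_eta_ge0.
have theta_neq0 i : theta i != 0.
  exact: lt0r_neq0 (theta_coef_gt0 P_idem P_sum Q_idem PQ_bal xi_gt0
    rho_eta_ge0 R_idem QR QR_bal i).
have RVR i : R i *m invmx V *m R i = theta i *: R i.
  by rewrite VV (R_inv_cov_sum_R P_idem P_sum Q_idem PQ_bal xi_gt0 rho_eta_ge0
    R_idem QR QR_bal).
have [_ R_sym R_idemp _] := R_idem.
(* The Moore-Penrose inverse of theta R is R / theta, and the extra factor R is absorbed by
   idempotence. *)
have estimatorE i t : estimator i t = (theta i)^-1 *: (R i *m invmx V) *m Y t.
  rewrite /estimator RVR moore_penrose_scale_projector // -!scalemxAl.
  by rewrite R_idemp.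
split=> // [q|i].
  exact: lt0r_neq0 (one_add_alpha_gt0 P_idem P_sum Q_idem PQ_bal xi_gt0
    rho_eta_ge0 q).
split=> // [t|].
  rewrite estimatorE VV (R_mul_inv_cov_sum_expand P_idem P_sum Q_idem PQ_bal xi_gt0
    rho_eta_ge0 R_idem QR).
  rewrite -scalemxAl mulmx_suml; congr (_ *: _); apply: eq_bigr => p _.
  by rewrite mulmx_suml; apply: eq_bigr => q _; rewrite -scalemxAl.
have Y2 : square_integrable Pr Y.
  apply: square_integrable_add; last exact: square_integrable_cst.
  by apply: square_integrable_add => //; exact: square_integrable_mulmx.
have -> : estimator i = fun t => (theta i)^-1 *: (R i *m invmx V) *m Y t.
  by apply/funext => t; exact: estimatorE.
(* The variance is theta^-2 R V^-1 V V^-1 R = theta^-2 R V^-1 R, which [RVR] reduces to R /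
   theta. *)
rewrite cov_mx_mulmx // -/V linearZ /= trmx_mul trmx_inv R_sym.
have -> : V^T = V by rewrite VE; exact: cov_sum_tr P_idem Q_idem.
rewrite -!scalemxAl -scalemxAr -!mulmxA mulKmx // mulmxA RVR !scalerA.
by rewrite mulfVK.
Qed.
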